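(* Let $X$ and $Y$ be two one-sided shifts of finite type and suppose that $\phi:\mathcal{G}_X\to\mathcal{G}_Y$ is an isomorphism of topological groupoids. Then there is a continuous orbit equivalence $h:X\to Y$, an $h$-cocycle pair $(k,l)$ such that $$\phi\bigl((x,r-s,x')\bigr)=\left(h(x),\ \sum_{i=0}^{r-1}[l(\sigma_X^i(x))-k(\sigma_X^i(x))]-\sum_{j=0}^{s-1}[l(\sigma_X^j(x'))-k(\sigma_X^j(x'))],\ h(x')\right)$$ for all $(x,r-s,x')\in\mathcal{G}_X$ with $r,s\in\mathbb{N}_0$ and $\sigma_X^r(x)=\sigma_X^s(x')$, and an $h^{-1}$-cocycle pair $(k',l')$ such that $$\phi^{-1}\bigl((y,r'-s',y')\bigr)=\left(h^{-1}(y),\ \sum_{i=0}^{r'-1}[l'(\sigma_Y^i(y))-k'(\sigma_Y^i(y))]-\sum_{j=0}^{s'-1}[l'(\sigma_Y^j(y'))-k'(\sigma_Y^j(y'))],\ h^{-1}(y')\right)$$ for all $(y,r'-s',y')\in\mathcal{G}_Y$ with $r',s'\in\mathbb{N}_0$ and $\sigma_Y^{r'}(y)=\sigma_Y^{s'}(y')$. The $h$-cocycle pair $(k,l)$ and the $h^{-1}$-cocycle pair $(k',l')$ are least period preserving if and only if $\phi((x,\operatorname{lp}(x),x))=(h(x),\operatorname{lp}(h(x)),h(x))$ for every eventually periodic $x\in X$, in which case there exist continuous maps $b,n:X\to\mathbb{N}_0$ and $b',n':Y\to\mathbb{N}_0$ such that $l(x)-k(x)=n(x)+b(x)-b(\sigma_X(x))$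 and $l'(y)-k'(y)=n'(y)+b'(y)-b'(\sigma_Y(y))$ for all $x\in X$ and $y\in Y$.
   Context: $\mathbb{N}$ is the set of positive integers and $\mathbb{N}_0$ the set of non-negative integers (discrete topology). One-sided shift space: a closed subset $X\subseteq \boldsymbol{a}^{\mathbb{N}_0}$ ($\boldsymbol{a}$ a finite discrete alphabet, product topology) with $\sigma(X)=X$, where $(\sigma(x))_j=x_{j+1}$; $\sigma_X$ is the restriction of $\sigma$ to $X$. $\mathcal{L}(X)$ is the set of finite words (including the empty word) appearing in elements of $X$. $X$ is a one-sided shift of finite type if there is $m\in\mathbb{N}$ such that whenever $v\in\mathcal{L}(X)$ has length $m$ and $uv,vw\in\mathcal{L}(X)$, then $uvw\in\mathcal{L}(X)$. A point $x\in X$ is periodic if $\sigma_X^p(x)=x$ for some $p\in\mathbb{N}$, and eventually periodic if $\sigma_X^n(x)$ is periodic for some $n\in\mathbb{N}_0$. For eventually periodic $x$, its least period is $\operatorname{lp}(x):=\min\{p\in\mathbb{N}:\exists n,m\in\mathbb{N}_0,\ p=n-m,\ \sigma_X^n(x)=\sigma_X^m(x)\}$. A homeomorphism $h:X\to Y$ is a continuous orbit equivalence if there exist continuous maps $k,l:X\to\mathbb{N}_0$ and $k',l':Y\to\mathbb{N}_0$ with $\sigma_Y^{k(x)}(h(\sigma_X(x)))=\sigma_Y^{l(x)}(h(x))$ for all $x\in X$ and $\sigma_X^{k'(y)}(h^{-1}(\sigma_Y(y)))=\sigma_X^{l'(y)}(h^{-1}(y))$ for all $y\in Y$. A pair $(k,l)$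 of continuous maps satisfying the first identity is an $h$-cocycle pair; a pair $(k',l')$ of continuous maps satisfying the second is an $h^{-1}$-cocycle pair. For a continuous orbit equivalence $h$ such that $h(x)$ is eventually periodic exactly when $x$ is (any continuous orbit equivalence between one-sided shifts of finite type has this property), an $h$-cocycle pair $(k,l)$ is least period preserving if $\operatorname{lp}(h(x))=\sum_{i=0}^{\operatorname{lp}(x)-1}\bigl(l(\sigma_X^i(x))-k(\sigma_X^i(x))\bigr)$ for every eventually periodic point $x\in X$; for $h^{-1}$-cocycle pairs exchange the roles of $X$ and $Y$ (and replace $h$ by $h^{-1}$). For a one-sided shift of finite type $X$, $\mathcal{G}_X:=\{(x,n,x')\in X\times\mathbb{Z}\times X:\exists i,j\in\mathbb{N}_0,\ n=i-j,\ \sigma_X^i(x)=\sigma_X^j(x')\}$ with unit space $X$ (identified with $\{(x,0,x):x\in X\}$), range map $(x,n,x')\mapsto x$, source map $(x,n,x')\mapsto x'$, $(x,n,x')(x',n',x'')=(x,n+n',x'')$, $(x,n,x')^{-1}=(x',-n,x)$. Its topology has as basis the sets $\{(x,i-j,x'):x\in U,\ x'\in U',\ \sigma_X^i(x)=\sigma_X^j(x')\}$ where $i,j\in\mathbb{N}_0$, $U,U'\subseteq X$ are open, $\sigma_X^i|_U$ and $\sigma_X^j|_{U'}$ are injective, and $\sigma_X^i(U)=\sigma_X^j(U')$. A homomorphism of topological groupoids is a continuous map preserving inverses and products (the product of the images being defined whenever the product is); an isomorphism is a bijective homomorphism whose inverse is also a homomorphism.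
   Formalization: The least period preserving identity is required only at periodic points, not at every eventually periodic point; with the latter the ''if and only if'' fails for an explicit automorphism of the groupoid of the full 2-shift. *)

(* Defs.v *)
From HB Require Import structures.
From mathcomp Require Import all_boot all_order all_algebra.
From mathcomp Require Import all_classical all_reals topology.
Set Implicit Arguments.
Unset Strict Implicit.
Unset Printing Implicit Defensive.
Import Order.TTheory GRing.Theory Num.Theory.
Local Open Scope classical_set_scope.
Local Open Scope ring_scope.

(** * One-sided shift spaces *)

Definition full_shift (A : finType) : topologicalType :=
  {ptws nat -> discrete_topology A}.

Definition shift {A : finType} (x : full_shift A) : full_shift A :=
  fun j => x j.+1.

Record shift_space (A : finType) := ShiftSpace {
  points :> set (full_shift A);
  points_closed : closed points;
  points_shift : shift @` points = points
}.

(* A shift space [X] coerces to the type of its points, the library's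
   [set_type], which carries the subspace topology. *)

Lemma points_shiftP {A : finType} (X : shift_space A) (x : full_shift A) :
  points X x -> points X (shift x).
Proof. by move=> Xx; rewrite -points_shift; exists x. Qed.

Definition sigma {A : finType} {X : shift_space A} (x : X) : X :=
  exist _ (shift (val x)) (mem_set (points_shiftP (set_valP x))).

Definition language {A : finType} (X : shift_space A) : set (seq A) :=
  [set w | exists x : X, exists i : nat,
     w = mkseq (fun j => (val x : nat -> A) (i + j)%N) (size w)].

Definition finite_type {A : finType} (X : shift_space A) : Prop :=
  exists2 m : nat, (0 < m)%N &
    forall u v w : seq A, size v = m -> language X v ->
      language X (u ++ v) -> language X (v ++ w) ->
      language X (u ++ v ++ w).

(** * Periodic points *)

Definition periodic {A : finType} {X : shift_space A} (x : X) : Prop :=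
  exists2 p : nat, (0 < p)%N & iter p sigma x = x.

Definition eventually_periodic {A : finType} {X : shift_space A} (x : X) :
  Prop := exists n : nat, periodic (iter n sigma x).

Definition is_period {A : finType} {X : shift_space A} (x : X) (p : nat) :
  Prop :=
  (0 < p)%N /\ exists n m : nat,
    p%:Z = n%:Z - m%:Z /\ iter n sigma x = iter m sigma x.

Lemma is_period_ex {A : finType} {X : shift_space A} (x : X) :
  eventually_periodic x -> exists p, `[< is_period x p >].
Proof.
move=> [n [p p0 xp]]; exists p; apply/asboolP; split=> //.
by exists (p + n)%N, n; rewrite iterD xp PoszD addrK.
Qed.

(* The least period, with the junk value 0 if [x] is not eventually periodic. *)
Definition lp {A : finType} {X : shift_space A} (x : X) : nat :=
  match pselect (eventually_periodic x) with
  | left ex => ex_minn (is_period_ex ex)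
  | right _ => 0%N
  end.

Lemma lpP {A : finType} {X : shift_space A} (x : X) :
  eventually_periodic x ->
  is_period x (lp x) /\ forall p, is_period x p -> (lp x <= p)%N.
Proof.
move=> ex; rewrite /lp; case: pselect => // e.
case: ex_minnP => p /asboolP px pmin; split=> // q xq.
by apply: pmin; apply/asboolP.
Qed.

(** * Continuous orbit equivalence *)

Definition homeomorphism {S T : topologicalType} (h : S -> T) (hinv : T -> S) :
  Prop :=
  [/\ continuous h, continuous hinv, cancel h hinv & cancel hinv h].

(* An h^-1-cocycle pair is a [cocycle_pair] for the inverse map. *)
Definition cocycle_pair {A B : finType} {X : shift_space A} {Y : shift_space B}
    (h : X -> Y) (k l : X -> nat) : Prop :=
  [/\ continuous k, continuous l &
      forall x : X, iter (k x) sigma (h (sigma x)) = iter (l x) sigma (h x)].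

Definition continuous_orbit_equivalence {A B : finType}
    {X : shift_space A} {Y : shift_space B} (h : X -> Y) (hinv : Y -> X) :
  Prop :=
  [/\ homeomorphism h hinv,
      exists k l : X -> nat, cocycle_pair h k l &
      exists k' l' : Y -> nat, cocycle_pair hinv k' l'].

Definition cocycle_sum {A : finType} {X : shift_space A} (k l : X -> nat)
    (r : nat) (x : X) : int :=
  \sum_(0 <= i < r)
    ((l (iter i sigma x))%:Z - (k (iter i sigma x))%:Z).

(* Only periodic points are quantified over.  For [x] eventually periodic but
   not periodic, [x], ..., [sigma^(lp x - 1) x] is not a cycle, and demanding the
   identity there would not be invariant under replacing [l - k] by a
   cohomologous function: on the full 2-shift let h send 0z, 10z, 11z to 00z,
   01z, 1z.  Then phi (x, n, x') = (h x, d x + n - d x', h x'), with d = 1, 0, -1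
   on the three cylinders, is an automorphism of the groupoid which maps
   (x, lp x, x) to (h x, lp (h x), h x), but at x = 1000... one has
   l x - k x = 0 while lp (h x) = lp x = 1. *)
Definition least_period_preserving {A B : finType}
    {X : shift_space A} {Y : shift_space B} (h : X -> Y) (k l : X -> nat) :
  Prop :=
  forall x : X, periodic x ->
    (lp (h x))%:Z = cocycle_sum k l (lp x) x.

(** * The groupoid of a shift space *)

Definition is_arrow {A : finType} {X : shift_space A} (g : X * int * X) :
  Prop :=
  exists i j : nat,
    g.1.2 = i%:Z - j%:Z /\ iter i sigma g.1.1 = iter j sigma g.2.

Record groupoid {A : finType} (X : shift_space A) := Arrow {
  triple : X * int * X;
  tripleP : is_arrow triple
}.

Definition range_of {A : finType} {X : shift_space A} (g : groupoid X) : X :=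
  (triple g).1.1.

Definition degree {A : finType} {X : shift_space A} (g : groupoid X) : int :=
  (triple g).1.2.

Definition source_of {A : finType} {X : shift_space A} (g : groupoid X) : X :=
  (triple g).2.

Lemma arrow_inv_subproof {A : finType} {X : shift_space A} (g : groupoid X) :
  is_arrow (source_of g, - degree g, range_of g).
Proof.
by case: (tripleP g) => i [j [nE xE]]; exists j, i; rewrite /degree/= nE opprB.
Qed.

Definition arrow_inv {A : finType} {X : shift_space A} (g : groupoid X) :
  groupoid X := Arrow (arrow_inv_subproof g).

Definition composable {A : finType} {X : shift_space A} (g g' : groupoid X) :
  Prop := source_of g = range_of g'.

Lemma arrow_mul_subproof {A : finType} {X : shift_space A}
    (g g' : groupoid X) :
  composable g g' ->
  is_arrow (range_of g, degree g + degree g', source_of g').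
Proof.
move=> gg'; case: (tripleP g) (tripleP g') => i [j [gE xE]] [a [b [g'E yE]]].
exists (a + i)%N, (j + b)%N; split=> /=.
  by rewrite /degree gE g'E !PoszD opprD addrACA [i%:Z + _]addrC.
rewrite iterD xE -/(source_of g) gg' -iterD addnC iterD.
by rewrite -[range_of g']/((triple g').1.1) yE -iterD.
Qed.

Definition arrow_mul {A : finType} {X : shift_space A} (g g' : groupoid X)
    (gg' : composable g g') : groupoid X := Arrow (arrow_mul_subproof gg').

Lemma arrow_of_subproof {A : finType} {X : shift_space A} (x x' : X)
    (r s : nat) :
  iter r sigma x = iter s sigma x' -> is_arrow (x, r%:Z - s%:Z, x').
Proof. by move=> e; exists r, s. Qed.

Definition arrow_of {A : finType} {X : shift_space A} (x x' : X) (r s : nat)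
    (e : iter r sigma x = iter s sigma x') : groupoid X :=
  Arrow (arrow_of_subproof e).

Lemma lp_arrow_subproof {A : finType} {X : shift_space A} (x : X) :
  eventually_periodic x -> is_arrow (x, (lp x)%:Z, x).
Proof. by case/lpP=> -[_ [n [m [lpE xE]]]] _; exists n, m. Qed.

Definition lp_arrow {A : finType} {X : shift_space A} (x : X)
    (ex : eventually_periodic x) : groupoid X := Arrow (lp_arrow_subproof ex).

Definition basic_index {A : finType} (X : shift_space A) :
    set (nat * nat * set X * set X) :=
  [set p | let: (i, j, U, U') := p in
    [/\ open U, open U',
        {in U &, injective (iter i (@sigma A X))},
        {in U' &, injective (iter j (@sigma A X))} &
        iter i sigma @` U = iter j sigma @` U']].

Definition basic_set {A : finType} (X : shift_space A)
    (p : nat * nat * set X * set X) : set (groupoid X) :=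
  let: (i, j, U, U') := p in
  [set g | exists x x' : X,
    [/\ triple g = (x, i%:Z - j%:Z, x'), U x, U' x' &
        iter i sigma x = iter j sigma x']].

HB.instance Definition _ (A : finType) (X : shift_space A) :=
  gen_eqMixin (groupoid X).
HB.instance Definition _ (A : finType) (X : shift_space A) :=
  gen_choiceMixin (groupoid X).

(* The topology generated by the basic sets, which form a basis of it when [X]
   is of finite type, [sigma] then being a local homeomorphism. *)
HB.instance Definition _ (A : finType) (X : shift_space A) :=
  isSubBaseTopological.Build (groupoid X) (@basic_index A X) (@basic_set A X).

Record groupoid_hom {A B : finType} {X : shift_space A} {Y : shift_space B}
    (phi : groupoid X -> groupoid Y) : Prop := GroupoidHom {
  hom_continuous : continuous phi;
  hom_inv : forall g, phi (arrow_inv g) = arrow_inv (phi g);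
  hom_mul : forall g g' (gg' : composable g g'),
    exists pgg' : composable (phi g) (phi g'),
      phi (arrow_mul gg') = arrow_mul pgg'
}.

Record groupoid_iso {A B : finType} {X : shift_space A} {Y : shift_space B}
    (phi : groupoid X -> groupoid Y) (psi : groupoid Y -> groupoid X) :
  Prop := GroupoidIso {
  iso_hom : groupoid_hom phi;
  iso_inv_hom : groupoid_hom psi;
  iso_K : cancel phi psi;
  iso_inv_K : cancel psi phi
}.

Definition induced_by {A B : finType} {X : shift_space A} {Y : shift_space B}
    (phi : groupoid X -> groupoid Y) (h : X -> Y) (k l : X -> nat) : Prop :=
  forall (x x' : X) (r s : nat) (e : iter r sigma x = iter s sigma x'),
    triple (phi (arrow_of e)) =
      (h x, cocycle_sum k l r x - cocycle_sum k l s x', h x').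

Record implements {A B : finType} {X : shift_space A} {Y : shift_space B}
    (phi : groupoid X -> groupoid Y) (psi : groupoid Y -> groupoid X)
    (h : X -> Y) (hinv : Y -> X) (k l : X -> nat) (k' l' : Y -> nat) :
  Prop := Implements {
  impl_coe : continuous_orbit_equivalence h hinv;
  impl_pair : cocycle_pair h k l;
  impl_induced : induced_by phi h k l;
  impl_inv_pair : cocycle_pair hinv k' l';
  impl_inv_induced : induced_by psi hinv k' l'
}.

(* Main.v *)
Require Import Defs.
From mathcomp Require Import all_boot all_order all_algebra.
From mathcomp Require Import all_classical all_reals topology.
From mathcomp Require Import finmap zify.
Set Implicit Arguments.
Unset Strict Implicit.
Unset Printing Implicit Defensive.
Import Order.TTheory GRing.Theory Num.Theory.
Local Open Scope classical_set_scope.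
Local Open Scope ring_scope.

(* A groupoid homomorphism phi restricts to a continuous map h of unit
   spaces, and the degrees of the images of the arrows (x, 1, sigma x)
   form a locally constant cocycle d which determines phi, because these
   arrows generate the groupoid. Near each x the image of (x, 1, sigma x)
   lies in a fixed basic set, which gives sigma^i (h x) = sigma^j (h
   (sigma x)) with d = i - j; by compactness the same i = N works
   everywhere, so that l = N and k = N - d is a cocycle pair.

   The isotropy arrow (x, lp x, x) of an eventually periodic point is sent
   to the arrow whose degree is the sum of l - k over the cycle reached by
   x, which yields the characterization of least period preservation.
   Finally, if the locally constant function c = l - k has non-negative
   sums over all cycles, then the infimum of its Birkhoff sums over all
   orbits starting in a given sufficiently long cylinder is finite, and it
   is the potential b for which c - b + b o sigma is non-negative. *)

(** * Cylinders and compactness *)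

Definition agree {A : finType} (n : nat) (x y : full_shift A) : Prop :=
  forall i, (i < n)%N -> (y : nat -> A) i = (x : nat -> A) i.

Lemma agree_le {A : finType} (m n : nat) (x y : full_shift A) :
  (m <= n)%N -> agree n x y -> agree m x y.
Proof. by move=> mn xy i im; apply: xy; lia. Qed.

Lemma agree_trans {A : finType} (n : nat) (x y z : full_shift A) :
  agree n x y -> agree n y z -> agree n x z.
Proof. by move=> xy yz i im; rewrite yz // xy. Qed.

Lemma agree_sym {A : finType} (n : nat) (x y : full_shift A) :
  agree n x y -> agree n y x.
Proof. by move=> xy i im; rewrite xy. Qed.

(** A cylinder is a finite intersection of preimages of points under the coordinate projections.
    Conversely, the filter of cylinders around [x] converges to [x] in every coordinate, hence in
    the product topology. *)
Lemma nbhs_full_shiftP {A : finType} (x : full_shift A)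
    (U : set (full_shift A)) :
  nbhs x U <-> exists n, agree n x `<=` U.
Proof.
split=> [xU|[n]]; last first.
  move=> /filterS; apply; elim: n => [|n IHn].
    by apply: filterS filterT => y _ i.
  have xn : nbhs x (proj n @^-1` [set (x : nat -> A) n]).
    apply: (@proj_continuous nat (fun=> discrete_topology A) n x).
    exact/principal_filterP.
  apply: filterS (filterI IHn xn) => y [xy yn] i.
  by rewrite ltnS leq_eqVlt => /orP[/eqP ->|/xy].
pose F := filter_from [set: nat] (fun n => agree n x).
have FF : Filter F.
  apply: filter_from_filter; first by exists 0%N.
  move=> i j _ _; exists (i + j)%N => // y xy; split=> k ki; apply: xy; lia.
suff /(_ U xU)[n _ nU] : F --> x by exists n.
apply/cvg_sup => i; apply/cvg_image.
  by rewrite eqEsubset; split=> // a _; exists (fun=> a).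
move=> V /principal_filterP Vx; exists (fun y => V ((y : nat -> A) i)).
  by exists i.+1 => // y xy /=; rewrite xy.
rewrite eqEsubset; split=> [_ [y Vy <-]//|a Va]; by exists (fun=> a).
Qed.

Lemma nbhs_shiftP {A : finType} {X : shift_space A} (x : X) (U : set X) :
  nbhs x U <-> exists n, [set y : X | agree n (val x) (val y)] `<=` U.
Proof.
split=> [[_ [[V oV <-] Vx VU]]|[n nU]].
  have /nbhs_full_shiftP[n nV] : nbhs (val x) V by apply: open_nbhs_nbhs.
  by exists n => y /nV /VU.
have : nbhs (val x) (agree n (val x)) by apply/nbhs_full_shiftP; exists n.
move=> /(@initial_continuous X (full_shift A) set_val x) xn.
exact: filterS nU xn.
Qed.

Lemma shift_closed {A : finType} (X : shift_space A) (z : full_shift A) :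
  (forall n, exists x : X, agree n z (val x)) -> points X z.
Proof.
move=> Xz; apply: points_closed => U /nbhs_full_shiftP[n nU].
by have [x zx] := Xz n; exists (val x); split; [exact: set_valP|exact: nU].
Qed.

(** This is compactness in near-covering form, applied to the filter [\oo] of large integers:
    thresholds that depend on the point are replaced by a single one. *)
Lemma shift_compact {A : finType} (X : shift_space A) (P : nat -> X -> Prop) :
  (forall x : X, exists n, forall m (y : X), (n <= m)%N ->
     agree n (val x) (val y) -> P m y) ->
  exists N, forall x, P N x.
Proof.
move=> PX.
have cX : compact (points X).
  apply: (@subclosed_compact _ _ [set: full_shift A]) => //.
    exact: points_closed.
  have := @tychonoff nat (fun=> discrete_topology A) (fun=> setT).
  rewrite (_ : [set f | _] = setT); last first.
    by rewrite eqEsubset; split.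
  apply=> _; apply: (@finite_compact (discrete_topology A)).
  exact: (@finite_finset A).
(* [Q] carries [P] over to the ambient full shift, where [points X] is compact; it holds vacuously
   off [X]. *)
pose Q m (z : full_shift A) := forall y : X, val y = z -> P m y.
have /(_ nat \oo Q _) : near_covering (points X).
  exact/compact_near_coveringP.
case=> [z /mem_set Xz|N _ /(_ N (leqnn N)) PN]; last first.
  by exists N => x; apply: PN => //; exact: set_valP.
have [n Pn] := PX (exist _ z Xz).
exists (agree n z, [set m | (n <= m)%N]); first split => /=.
- by apply/nbhs_full_shiftP; exists n.
- by exists n.
- by move=> [z' m]/= [zz' nm] y yz; apply: Pn => //=; rewrite yz.
Qed.

Definition window_dependent {A : finType} {X : shift_space A} {T : Type}
    (M : nat) (f : X -> T) : Prop :=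
  forall x y : X, agree M (val x) (val y) -> f y = f x.

Lemma continuous_natP {A : finType} {X : shift_space A} (f : X -> nat) :
  continuous f <-> exists n, window_dependent n f.
Proof.
split=> [cf|[n fn] x U /principal_filterP Ux]; last first.
  by apply/nbhs_shiftP; exists n => y /fn /=; rewrite /preimage/= => ->.
(* The property made uniform is that [f] is constant on the cylinder of length [m] around [y]. *)
apply: shift_compact => x.
have /nbhs_shiftP[n nf] : nbhs x (f @^-1` [set f x]).
  by apply: cf; apply/principal_filterP.
exists n => m y nm xy z yz; rewrite (nf _ xy) (nf z) // => i ilt.
by rewrite yz ?xy//; lia.
Qed.

(** * Shifts of finite type *)

Lemma val_iter_sigma {A : finType} {X : shift_space A} (n : nat) (x : X) i :
  (val (iter n sigma x) : nat -> A) i = (val x : nat -> A) (n + i)%N.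
Proof. by elim: n i => [//|n IHn] i /=; rewrite /shift IHn addnS. Qed.

Lemma agree_iter {A : finType} {X : shift_space A} (i n : nat) (x y : X) :
  agree (i + n) (val x) (val y) ->
  agree n (val (iter i sigma x)) (val (iter i sigma y)).
Proof. by move=> xy j jn; rewrite !val_iter_sigma xy //; lia. Qed.

Lemma shift_point_eq {A : finType} {X : shift_space A} (x y : X) :
  (forall n, agree n (val x) (val y)) -> x = y.
Proof. by move=> xy; apply/val_inj/funext => i; rewrite (xy i.+1). Qed.

(** The finite type condition in terms of points: the first [i] letters of [x] can be put in front
    of [z] as soon as [z] starts with the [m] letters that follow them in [x]. *)
Definition memory {A : finType} (X : shift_space A) (m : nat) : Prop :=
  forall i (x z : X), agree m (val (iter i sigma x)) (val z) ->
    exists2 w : X, iter i sigma w = z & agree (i + m) (val x) (val w).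

Lemma memory_le {A : finType} {X : shift_space A} (m n : nat) :
  (m <= n)%N -> memory X m -> memory X n.
Proof.
move=> mn Xm i x z xz.
have [w wz xw] := Xm i x z (agree_le mn xz).
exists w => // j jn; case: (ltnP j (i + m)) => [|jim]; first exact: xw.
have ij : (i <= j)%N by lia.
by rewrite -(subnKC ij) -!val_iter_sigma wz xz //; lia.
Qed.

Lemma finite_type_memory {A : finType} {X : shift_space A} :
  finite_type X -> exists m, memory X m.
Proof.
move=> [m _ Xm]; exists m => i x z xz.
pose t : full_shift A :=
  fun j => if (j < i)%N then (val x : nat -> A) j
           else (val z : nat -> A) (j - i)%N.
have tx j : (j < i + m)%N -> t j = (val x : nat -> A) j.
  rewrite /t => jim; case: ltnP => // ij; rewrite xz; last by lia.
  by rewrite val_iter_sigma subnKC.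
have tz j : t (i + j)%N = (val z : nat -> A) j.
  by rewrite /t ltnNge leq_addr /= addKn.
have Xt : points X t.
  apply: shift_closed => n.
  have lang (y : X) s : s = mkseq (val y : nat -> A) (size s) -> language X s.
    by move=> sE; exists y, 0%N.
  (* The word [u ++ v] comes from [x] and [v ++ w] from [z], with overlap [v] of length [m], so
     finite type puts [u ++ v ++ w], an initial word of [t], into the language. *)
  pose u := mkseq t i; pose v := mkseq (fun j => t (i + j)%N) m.
  pose w := mkseq (fun j => t (i + m + j)%N) n.
  have catE (f : nat -> A) a b :
      mkseq f a ++ mkseq (fun j => f (a + j)%N) b = mkseq f (a + b).
    rewrite /mkseq iotaD map_cat add0n.
    by rewrite -[in iota a b](addn0 a) iotaDl -map_comp.
  have [||||y [a]] := Xm u v w; first by rewrite size_mkseq.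
  - apply: (lang z); rewrite size_mkseq; apply: eq_mkseq => j; exact: tz.
  - rewrite /u /v catE; apply: (lang x); rewrite size_mkseq.
    by apply/eq_in_map => j; rewrite mem_iota => /andP[_]; exact: tx.
  - have -> : w = mkseq (fun j => t (i + (m + j))%N) n.
      by apply: eq_mkseq => j; rewrite addnA.
    rewrite /v (catE (fun j => t (i + j)%N)).
    by apply: (lang z); rewrite size_mkseq; apply: eq_mkseq => j; exact: tz.
  rewrite catA /u /v catE /w catE size_mkseq => /(congr1 (nth (t 0%N))) E.
  exists (iter a sigma y) => j jn; have := congr1 (@^~ j) E.
  by rewrite !nth_mkseq ?val_iter_sigma//; lia.
exists (exist _ t (mem_set Xt)); last by move=> j /tx.
by apply: shift_point_eq => n j _; rewrite val_iter_sigma -tz.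
Qed.

(** A closing lemma: since [x] sees the same [m] letters again after [p] steps, its first [p]
    letters can be glued to themselves indefinitely. *)
Lemma memory_periodic {A : finType} {X : shift_space A} (m p : nat) (x : X) :
  memory X m -> (0 < p)%N -> agree m (val x) (val (iter p sigma x)) ->
  exists2 w : X, iter p sigma w = w & agree (p + m) (val x) (val w).
Proof.
move=> Xm p0 xp.
pose t : full_shift A := fun j => (val x : nat -> A) (j %% p)%N.
have tp j : t (p + j)%N = t j by rewrite /t modnDl.
have tx j : (j < p + m)%N -> t j = (val x : nat -> A) j.
  elim/ltn_ind: j => j IHj jpm; case: (ltnP j p) => [jp|pj].
    by rewrite /t modn_small.
  rewrite -(subnKC pj) tp IHj; [|lia..].
  by rewrite -val_iter_sigma xp //; lia.
have Xt : points X t.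
  apply: shift_closed => n.
  (* Each induction step prepends one more copy of the block of length [p]; as [p] is positive, [n]
     copies cover the first [n] letters. *)
  suff [y ty] : exists y : X, agree (n * p + m) t (val y).
    by exists y => j jn; apply: ty; nia.
  elim: n => [|n [y IHy]]; first by exists x => j jm; rewrite tx //; lia.
  have [|w wy xw] := Xm p x y.
    move=> j jm; rewrite xp // IHy ?tx //; lia.
  exists w => j jn; case: (ltnP j p) => jp; first by rewrite xw ?tx //; lia.
  rewrite -(subnKC jp) tp -val_iter_sigma wy IHy //; lia.
exists (exist _ t (mem_set Xt)); last by move=> j /tx.
by apply: shift_point_eq => n j _; rewrite val_iter_sigma /= tp.
Qed.

(** * Cocycle sums *)

Lemma periodic_eventually {A : finType} {X : shift_space A} (x : X) :
  periodic x -> eventually_periodic x.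
Proof. by exists 0%N. Qed.

(** The definition of [lp] tolerates a transient of length [m]. On a periodic point it is undone by
    [m * p - m] further steps, which lead from [iter m sigma x] back to [x]. *)
Lemma iter_lp {A : finType} {X : shift_space A} (x : X) :
  periodic x -> (0 < lp x)%N /\ iter (lp x) sigma x = x.
Proof.
move=> px; have [[lp0 [n [m [nm xnm]]]] _] := lpP (periodic_eventually px).
split=> //; have [p p0 xp] := px.
have nE : n = (lp x + m)%N by lia.
have xE' : iter (m * p) sigma x = x by rewrite iterM iter_fix.
have xE : iter (m * p - m) sigma (iter m sigma x) = x.
  by rewrite -iterD subnK // leq_pmulr.
rewrite -{2}xE' -[RHS]xE -xnm nE -!iterD.
by congr (iter _ _ _); have := leq_pmulr m p0; lia.
Qed.

Lemma cocycle_sumD {A : finType} {X : shift_space A} (k l : X -> nat) r s x :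
  cocycle_sum k l (r + s) x =
    cocycle_sum k l r x + cocycle_sum k l s (iter r sigma x).
Proof.
rewrite /cocycle_sum (big_cat_nat _ (leq_addr s r)) //=; congr (_ + _).
rewrite -{1}[r]add0n big_addn addKn; apply: eq_bigr => i _.
by rewrite -!iterD.
Qed.

Lemma cocycle_sum_periodic_ge0 {A : finType} {X : shift_space A}
    (k l : X -> nat) (p : nat) (x : X) :
  (forall x : X, periodic x -> 0 <= cocycle_sum k l (lp x) x) ->
  iter p sigma x = x -> 0 <= cocycle_sum k l p x.
Proof.
move=> kl; elim/ltn_ind: p => -[|p] IHp xp.
  by rewrite /cocycle_sum big_geq.
have px : periodic x by exists p.+1.
have [lp0 xlp] := iter_lp px.
have lep : (lp x <= p.+1)%N.
  have [_] := lpP (periodic_eventually px); apply; split=> //.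
  by exists p.+1, 0%N; rewrite subr0.
rewrite -(subnKC lep) cocycle_sumD xlp addr_ge0 ?kl // IHp //; first by lia.
by move: xp; rewrite -{1}(subnK lep) iterD xlp.
Qed.

Lemma cocycle_sum_window {A : finType} {X : shift_space A} (k l : X -> nat)
    (M r : nat) :
  window_dependent M k -> window_dependent M l ->
  window_dependent (r + M) (cocycle_sum k l r).
Proof.
move=> kM lM x y xy; apply: eq_big_nat => i /andP[_ ir].
have xyi : agree M (val (iter i sigma x)) (val (iter i sigma y)).
  by apply: agree_iter; apply: agree_le xy; lia.
by rewrite (kM _ _ xyi) (lM _ _ xyi).
Qed.

(* A long orbit segment returns to a window it has already seen; cutting out
   the loop in between removes the cocycle sum of a periodic point, which is
   non-negative.  So it suffices to bound the sums with at most as many terms as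
   there are windows. *)
Lemma cocycle_sum_bounded_below {A : finType} {X : shift_space A}
    (k l : X -> nat) (M : nat) :
  memory X M -> window_dependent M k -> window_dependent M l ->
  (forall x : X, periodic x -> 0 <= cocycle_sum k l (lp x) x) ->
  exists K : nat, forall r (x : X), 0 <= K%:Z + cocycle_sum k l r x.
Proof.
move=> XM kM lM kl.
have [C kC] : exists C : nat, forall x : X, (k x <= C)%N.
  apply: shift_compact => x; exists (M + k x)%N => m y le xy.
  by rewrite (kM x y); [lia|apply: agree_le xy; lia].
pose N := #|{ffun 'I_M -> A}|.
(* Each term is at least [- C] because [l] is non-negative, so [C * N] compensates for any sum of at
   most [N] terms. *)
exists (C * N)%N; elim/ltn_ind => r IHr x; case: (leqP r N) => [rN|Nr].
  have : - (r * C)%:Z <= cocycle_sum k l r x; last by nia.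
  elim: {IHr rN} r x => [|r IHr] x; first by rewrite /cocycle_sum big_geq.
  rewrite -addn1 cocycle_sumD {2}/cocycle_sum big_nat1 /=.
  have := IHr x; have := kC (iter r sigma x).
  move: (k _) (l _) (cocycle_sum _ _ _ _) => a b c.
  by rewrite mulnDl mul1n; lia.
pose f (i : 'I_N.+1) := [ffun j : 'I_M => (val (iter i sigma x) : nat -> A) j].
have /injectivePn[i0 [j0 ij0 fij0]] : ~~ injectiveb f.
  by apply/negP => /injectiveP /leq_card; rewrite card_ord ltnn.
wlog ltij : i0 j0 ij0 fij0 / (i0 < j0)%N.
  move=> H; case: (ltngtP i0 j0) => [|ji|/val_inj ij]; first exact: H.
    by apply: (H j0 i0) => //; rewrite eq_sym.
  by rewrite ij eqxx in ij0.
have ltjN : (j0 <= N)%N by rewrite -ltnS.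
have xij : agree M (val (iter i0 sigma x)) (val (iter j0 sigma x)).
  by move=> a aM; have /ffunP/(_ (Ordinal aM)) := fij0; rewrite !ffunE.
move: (nat_of_ord i0) (nat_of_ord j0) ltij ltjN xij => i j ltij ltjN xij.
(* [w] follows [x] up to time [i] and then its tail from time [j], so the loop is cut out; [v] below
   is the periodic point tracing that loop. *)
have [w wj xw] := XM i x _ xij.
pose p := (j - i)%N.
have jE : j = (i + p)%N by rewrite subnKC // ltnW.
have [||v vp xv] := memory_periodic XM (p := p) (x := iter i sigma x).
- by rewrite subn_gt0.
- by rewrite -iterD subnK // ltnW.
have vge0 := cocycle_sum_periodic_ge0 kl vp.
have -> : cocycle_sum k l r x = cocycle_sum k l i x + cocycle_sum k l p v +
    cocycle_sum k l (r - j) (iter j sigma x).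
  have rE : r = (j + (r - j))%N by lia.
  rewrite {1}rE cocycle_sumD {1}jE cocycle_sumD.
  by rewrite (cocycle_sum_window kM lM xv).
have lt_rp : (i + (r - j) < r)%N by lia.
have := IHr _ lt_rp w; rewrite cocycle_sumD wj.
rewrite (cocycle_sum_window kM lM xw) => ge0.
by have := addr_ge0 ge0 vge0; rewrite -!addrA [_ + cocycle_sum k l p v]addrC.
Qed.

Lemma cohomologous_ge0 {A : finType} {X : shift_space A} (k l : X -> nat) :
  finite_type X -> continuous k -> continuous l ->
  (forall x : X, periodic x -> 0 <= cocycle_sum k l (lp x) x) ->
  exists b n : X -> nat, [/\ continuous b, continuous n &
    forall x, (l x)%:Z - (k x)%:Z = (n x)%:Z + (b x)%:Z - (b (sigma x))%:Z].
Proof.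
move=> /finite_type_memory[m Xm].
move=> /continuous_natP[Mk kM] /continuous_natP[Ml lM] kl.
(* One length serves as memory of [X] and as window of both [k] and [l]. *)
pose M := (m + Mk + Ml)%N.
have XM : memory X M by apply: memory_le Xm; lia.
have {}kM : window_dependent M k.
  by move=> x y xy; apply: kM; apply: agree_le xy; lia.
have {}lM : window_dependent M l.
  by move=> x y xy; apply: lM; apply: agree_le xy; lia.
have [K KP] := cocycle_sum_bounded_below XM kM lM kl.
(* [Q x] collects the Birkhoff sums over orbits starting in the [M]-cylinder of [x], shifted by [K]
   into the natural numbers. Their minimum [b x] depends only on that cylinder, whence its
   continuity. *)
pose Q (x : X) (v : nat) := exists r (z : X),
  agree M (val x) (val z) /\ v%:Z = K%:Z + cocycle_sum k l r z.
have Q_ex x : exists v, `[< Q x v >].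
  exists K; apply/asboolP; exists 0%N, x; split=> //.
  by rewrite /cocycle_sum big_geq // addr0.
pose b x := ex_minn (Q_ex x).
have bP x : Q x (b x) by rewrite /b; case: ex_minnP => v /asboolP.
have b_min x v : Q x v -> (b x <= v)%N.
  by rewrite /b; case: ex_minnP => w _ wmin Qv; apply/wmin/asboolP.
have bM : window_dependent M b.
  have le x y : agree M (val x) (val y) -> (b y <= b x)%N.
    move=> xy; apply: b_min; have [r [z [xz zE]]] := bP x.
    by exists r, z; split=> //; apply: agree_trans xz; exact: agree_sym.
  move=> x y xy; apply/eqP; rewrite eqn_leq le // le //; exact: agree_sym.
have b_sub x : 0 <= (l x)%:Z - (k x)%:Z - (b x)%:Z + (b (sigma x))%:Z.
  have [r [z [xz zE]]] := bP (sigma x).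
  (* Prepending the first letter of [x] to a minimizer [z] for [sigma x] gives a competitor for [x]
     whose first term is [l x - k x]. *)
  have [w wz xw] := XM 1%N x z xz.
  have xwM : agree M (val x) (val w) by apply: agree_le xw.
  have : Q x `|(K%:Z + cocycle_sum k l r.+1 w)%R|%N.
    by exists r.+1, w; split=> //; rewrite gez0_abs.
  move=> /b_min; rewrite -lez_nat gez0_abs // -add1n cocycle_sumD wz.
  by rewrite {1}/cocycle_sum big_nat1 /= (kM _ _ xwM) (lM _ _ xwM); lia.
pose n x := `|((l x)%:Z - (k x)%:Z - (b x)%:Z + (b (sigma x))%:Z)%R|%N.
exists b, n; split; last by move=> x; rewrite /n gez0_abs //; lia.
  by apply/continuous_natP; exists M.
apply/continuous_natP; exists M.+1 => x y xy.
have xyM : agree M (val x) (val y) by apply: agree_le xy.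
have sxy : agree M (val (sigma x)) (val (sigma y)).
  exact: (@agree_iter _ _ 1).
by rewrite /n (kM _ _ xyM) (lM _ _ xyM) (bM _ _ xyM) (bM _ _ sxy).
Qed.

(** * Groupoid homomorphisms *)

Lemma triple_inj {A : finType} {X : shift_space A} :
  injective (@triple A X).
Proof.
move=> [g gP] [g' gP'] /= gg'; rewrite -gg' in gP' *.
by congr Arrow; exact: Prop_irrelevance.
Qed.

(** * Topology of the groupoid *)

Lemma open_basic_set {A : finType} {X : shift_space A}
    (p : nat * nat * set X * set X) :
  basic_index p -> open (basic_set p).
Proof.
move=> Xp; exists [set basic_set p]; last by rewrite bigcup_set1.
move=> _ ->; exists [fset p]%fset; first by move=> q /fset1P ->; exact/mem_set.
by rewrite set_fset1 bigcap_set1.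
Qed.

Lemma continuous_basic_set {A : finType} {X : shift_space A}
    {T : topologicalType} (f : T -> groupoid X) :
  (forall p, basic_index p -> open (f @^-1` basic_set p)) -> continuous f.
Proof.
move=> fo t U; rewrite nbhsE => -[B [[D sD <-] [C DC Ct]] BU].
have [E sE CE] := sD _ DC.
have : nbhs t (f @^-1` C).
  rewrite -CE preimage_bigcap; apply: filter_bigI => p pE.
  apply: open_nbhs_nbhs; split; first by apply/fo/set_mem/sE.
  by move: Ct; rewrite -CE; apply.
by apply: filterS => y Cy; apply: BU; exists C.
Qed.

Lemma sigma_continuous {A : finType} {X : shift_space A} :
  continuous (@sigma A X).
Proof.
move=> x U /nbhs_shiftP[n nU]; apply/nbhs_shiftP; exists n.+1 => y xy.
by apply: nU; apply: (@agree_iter _ _ 1).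
Qed.

(** By the last hypothesis every way of writing [n] as [i - j] is a witness for the arrow, so the
    preimage of a basic set is either empty or the open set of the [x] in [U] with [f x] in [U']. *)
Lemma section_continuous {A : finType} {X : shift_space A} (n : int)
    (f : X -> X) (g : X -> groupoid X) :
  continuous f -> (forall x, triple (g x) = (x, n, f x)) ->
  (forall (i j : nat) x,
     n = i%:Z - j%:Z -> iter i sigma x = iter j sigma (f x)) ->
  continuous g.
Proof.
move=> cf gE fE; apply: continuous_basic_set => -[[[i j] U] U'] [oU oU' _ _ _].
have [nE|nE] := eqVneq n (i%:Z - j%:Z); last first.
  rewrite (_ : _ @^-1` _ = set0); first exact: open0.
  rewrite eqEsubset; split=> // x [y [y' [+ _ _ _]]].
  by rewrite gE => -[_ nE' _]; rewrite nE' eqxx in nE.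
rewrite (_ : _ @^-1` _ = U `&` (f @^-1` U')).
  by apply: openI => //; apply: open_comp.
rewrite eqEsubset; split=> x.
  move=> [y [y' [+ Uy Uy' _]]]; rewrite gE => -[xy _ xy'].
  by move: Uy Uy'; rewrite -xy -xy'.
by move=> [Ux Ufx]; exists x, (f x); rewrite gE nE; split=> //; exact: fE.
Qed.

Definition unit_arrow {A : finType} {X : shift_space A} (x : X) : groupoid X :=
  @arrow_of A X x x 0 0 erefl.

Definition step_arrow {A : finType} {X : shift_space A} (x : X) : groupoid X :=
  @arrow_of A X x (sigma x) 1 0 erefl.

Lemma unit_arrow_continuous {A : finType} {X : shift_space A} :
  continuous (@unit_arrow A X).
Proof.
apply: (@section_continuous _ _ 0 id) => [x|//|i j x ij]; first exact: cvg_id.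
by congr (iter _ _ _); lia.
Qed.

Lemma step_arrow_continuous {A : finType} {X : shift_space A} :
  continuous (@step_arrow A X).
Proof.
apply: (@section_continuous _ _ 1 sigma) => // [|i j x ij].
  exact: sigma_continuous.
by rewrite -iterSr; congr (iter _ _ _); lia.
Qed.

(** Take cylinders of lengths [i + m] and [j + m] around the two ends. By the memory property,
    [iter i sigma] and [iter j sigma] map them onto the same cylinder of length [m]. *)
Lemma basic_set_cover {A : finType} {X : shift_space A} (g : groupoid X)
    (i j : nat) :
  finite_type X -> degree g = i%:Z - j%:Z ->
  iter i sigma (range_of g) = iter j sigma (source_of g) ->
  exists U U' : set X, basic_index (i, j, U, U') /\
    basic_set (i, j, U, U') g.
Proof.
move=> /finite_type_memory[m Xm] gE.
have inj a (x : X) : {in [set y : X | agree (a + m) (val x) (val y)] &,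
    injective (iter a sigma)}.
  move=> y z /set_mem xy /set_mem xz yz; apply: shift_point_eq => n b _.
  have [ba|ab] := ltnP b a; first by rewrite xy ?xz//; lia.
  by rewrite -(subnKC ab) -!val_iter_sigma yz.
have sub a b (x y : X) : iter a sigma x = iter b sigma y ->
    iter a sigma @` [set z : X | agree (a + m) (val x) (val z)] `<=`
    iter b sigma @` [set z : X | agree (b + m) (val y) (val z)].
  move=> xy _ [z xz <-]; have [|w wz yw] := Xm b y (iter a sigma z).
    by rewrite -xy; apply: agree_iter.
  by exists w.
have ocyl a (x : X) : open [set y : X | agree a (val x) (val y)].
  rewrite openE => y xy; apply/nbhs_shiftP; exists a => z /=.
  exact: agree_trans.
case: g gE => -[[x n] x'] gP; rewrite /degree /range_of /source_of /= => nE xx'.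
exists [set y : X | agree (i + m) (val x) (val y)].
exists [set y : X | agree (j + m) (val x') (val y)].
split; first split => //; try exact: inj.
  by rewrite eqEsubset; split; apply: sub.
by exists x, x'; rewrite /= nE; split.
Qed.

(** * Homomorphisms, their maps of unit spaces and their cocycles *)

Definition base_map {A B : finType} {X : shift_space A} {Y : shift_space B}
    (phi : groupoid X -> groupoid Y) (x : X) : Y :=
  range_of (phi (unit_arrow x)).

(** A unit is idempotent, hence so is its image: its ends coincide and its degree equals twice
    itself. *)
Lemma hom_unit {A B : finType} {X : shift_space A} {Y : shift_space B}
    (phi : groupoid X -> groupoid Y) (x : X) :
  groupoid_hom phi -> phi (unit_arrow x) = unit_arrow (base_map phi x).
Proof.
move=> hphi; set u := unit_arrow x.
have uu : composable u u by [].
have [c uE] := hom_mul hphi uu.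
have uuE : arrow_mul uu = u by apply: triple_inj.
rewrite uuE in uE; apply: triple_inj => /=.
rewrite /base_map -/u; move: c uE; case: (phi u) => -[[y n] y'] gP c.
move=> /(congr1 (fun g => triple g)) /= [] nE.
rewrite /composable /source_of /range_of /= in c *.
by rewrite -c; congr (_, _, _); move: nE; rewrite /degree /=; lia.
Qed.

(** [g] is composable with the units at its two ends; composability of the images identifies the
    ends of [phi g]. *)
Lemma hom_triple {A B : finType} {X : shift_space A} {Y : shift_space B}
    (phi : groupoid X -> groupoid Y) (g : groupoid X) :
  groupoid_hom phi ->
  triple (phi g) =
    (base_map phi (range_of g), degree (phi g), base_map phi (source_of g)).
Proof.
move=> hphi.
have rg : composable (unit_arrow (range_of g)) g by [].
have sg : composable g (unit_arrow (source_of g)) by [].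
have [+ _] := hom_mul hphi rg; have [+ _] := hom_mul hphi sg.
rewrite !hom_unit // => sE rE.
rewrite (rE : base_map phi (range_of g) = _).
rewrite -(sE : _ = base_map phi (source_of g)).
by case: (phi g) => -[[]].
Qed.

Lemma hom_degreeM {A B : finType} {X : shift_space A} {Y : shift_space B}
    (phi : groupoid X -> groupoid Y) (g g' : groupoid X)
    (gg' : composable g g') :
  groupoid_hom phi ->
  degree (phi (arrow_mul gg')) = degree (phi g) + degree (phi g').
Proof. by move=> hphi; have [c ->] := hom_mul hphi gg'. Qed.

Lemma hom_degreeV {A B : finType} {X : shift_space A} {Y : shift_space B}
    (phi : groupoid X -> groupoid Y) (g : groupoid X) :
  groupoid_hom phi -> degree (phi (arrow_inv g)) = - degree (phi g).
Proof. by move=> hphi; rewrite hom_inv. Qed.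

Lemma base_map_continuous {A B : finType} {X : shift_space A}
    {Y : shift_space B} (phi : groupoid X -> groupoid Y) :
  groupoid_hom phi -> continuous (base_map phi).
Proof.
move=> hphi x V; rewrite nbhsE => -[W [oW Wx] WV].
have oB : open (@basic_set B Y (0%N, 0%N, W, W)).
  by apply: open_basic_set; split=> // ? ? _ _.
have : nbhs x ((phi \o unit_arrow) @^-1` basic_set (0%N, 0%N, W, W)).
  have : {for x, continuous (phi \o unit_arrow)}.
    apply: continuous_comp; first exact: unit_arrow_continuous.
    exact: (hom_continuous hphi).
  apply.
  apply: open_nbhs_nbhs; split; rewrite //= hom_unit //.
  by exists (base_map phi x), (base_map phi x).
apply: filterS => y [z [z' [zE Wz _ _]]]; apply: WV.
by rewrite /base_map /range_of zE.
Qed.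

Lemma base_mapK {A B : finType} {X : shift_space A} {Y : shift_space B}
    (phi : groupoid X -> groupoid Y) (psi : groupoid Y -> groupoid X) :
  groupoid_hom phi -> cancel phi psi -> cancel (base_map phi) (base_map psi).
Proof. by move=> hphi phiK x; rewrite {1}/base_map -hom_unit // phiK. Qed.

Lemma hom_step_locally {A B : finType} {X : shift_space A}
    {Y : shift_space B} (phi : groupoid X -> groupoid Y) (x : X) :
  finite_type Y -> groupoid_hom phi ->
  exists n i j : nat, forall y : X, agree n (val x) (val y) ->
    degree (phi (step_arrow y)) = i%:Z - j%:Z /\
    iter i sigma (base_map phi y) = iter j sigma (base_map phi (sigma y)).
Proof.
move=> sftY hphi; have [i [j [nE ij]]] := tripleP (phi (step_arrow x)).
have [U [U' [bU Ux]]] := basic_set_cover sftY nE ij.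
have : nbhs x ((phi \o step_arrow) @^-1` basic_set (i, j, U, U')).
  have : {for x, continuous (phi \o step_arrow)}.
    apply: continuous_comp; first exact: step_arrow_continuous.
    exact: (hom_continuous hphi).
  apply.
  by apply: open_nbhs_nbhs; split=> //; exact: open_basic_set.
move=> /nbhs_shiftP[n nV]; exists n, i, j => y /nV[z [z' []]].
by rewrite hom_triple // => -[-> -> ->].
Qed.

Lemma hom_cocycle_pair {A B : finType} {X : shift_space A}
    {Y : shift_space B} (phi : groupoid X -> groupoid Y) :
  finite_type Y -> groupoid_hom phi ->
  exists k l : X -> nat, cocycle_pair (base_map phi) k l /\
    forall x, degree (phi (step_arrow x)) = (l x)%:Z - (k x)%:Z.
Proof.
move=> sftY hphi; pose d (x : X) := degree (phi (step_arrow x)).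
have [N NP] : exists N, forall x : X, exists j : nat, d x = N%:Z - j%:Z /\
    iter N sigma (base_map phi x) = iter j sigma (base_map phi (sigma x)).
  apply: shift_compact => x.
  have [n [i [j nP]]] := hom_step_locally x sftY hphi.
  exists (n + i)%N => m y nm xy.
  have [|dE hE] := nP y; first by apply: agree_le xy; lia.
  (* Applying [sigma] another [m - i] times raises the local exponents [i] and [j] to [m] and
     [m - i + j]. *)
  exists (m - i + j)%N; split; first by rewrite /d dE; lia.
  by rewrite iterD -hE -iterD; congr (iter _ _ _); lia.
(* [N - d x] is the exponent [j] supplied by [NP], so the absolute value does not change it. *)
exists (fun x => `|N%:Z - d x|%N), (fun=> N); split; [split|] => [||x|x].
- move=> x U /principal_filterP Ux; apply/nbhs_shiftP.
  have [n [i [j nP]]] := hom_step_locally x sftY hphi.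
  exists n => y /nP[yE _]; have [//|xE _] := nP x.
  by move: Ux; rewrite /preimage /= /d xE yE.
- exact: cst_continuous.
- by have [j [-> ->]] := NP x; congr (iter _ _ _); lia.
- by have [j [E _]] := NP x; rewrite -/(d x) E; lia.
Qed.

Lemma hom_induced {A B : finType} {X : shift_space A}
    {Y : shift_space B} (phi : groupoid X -> groupoid Y) (k l : X -> nat) :
  groupoid_hom phi ->
  (forall x, degree (phi (step_arrow x)) = (l x)%:Z - (k x)%:Z) ->
  induced_by phi (base_map phi) k l.
Proof.
move=> hphi kl.
(* The arrow from [x] to [iter r sigma x] is a product of [r] step arrows. A general arrow is one of
   these times the inverse of another, meeting at [iter r sigma x]. *)
have sumE r (x z : X) (e : iter r sigma x = iter 0 sigma z) :
    degree (phi (arrow_of e)) = cocycle_sum k l r x.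
  elim: r z e => [|r IHr] z e.
    have -> : arrow_of e = unit_arrow x.
      by apply: triple_inj => /=; rewrite -[z]/(iter 0 sigma z) -e.
    by rewrite hom_unit // /cocycle_sum big_geq.
  have rx : iter r sigma x = iter 0 sigma (iter r sigma x) by [].
  have c : composable (arrow_of rx) (step_arrow (iter r sigma x)) by [].
  have -> : arrow_of e = arrow_mul c.
    apply: triple_inj => /=; rewrite -[z]/(iter 0 sigma z) -e /=.
    by congr (_, _, _); rewrite /degree /=; lia.
  by rewrite hom_degreeM // IHr kl /cocycle_sum big_nat_recr.
move=> x x' r s e; rewrite hom_triple //; congr (_, _, _).
have rx : iter r sigma x = iter 0 sigma (iter r sigma x) by [].
have sx : iter s sigma x' = iter 0 sigma (iter r sigma x) by [].
have c : composable (arrow_of rx) (arrow_inv (arrow_of sx)) by [].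
have -> : arrow_of e = arrow_mul c.
  by apply: triple_inj => /=; congr (_, _, _); do 2 rewrite /degree /=; lia.
by rewrite hom_degreeM // hom_degreeV // !sumE.
Qed.

Lemma iso_implements {A B : finType} {X : shift_space A}
    {Y : shift_space B} (phi : groupoid X -> groupoid Y)
    (psi : groupoid Y -> groupoid X) :
  finite_type X -> finite_type Y -> groupoid_iso phi psi ->
  exists (h : X -> Y) (hinv : Y -> X) (k l : X -> nat) (k' l' : Y -> nat),
    implements phi psi h hinv k l k' l'.
Proof.
move=> sftX sftY [hphi hpsi phiK psiK].
have [k [l [kl klE]]] := hom_cocycle_pair sftY hphi.
have [k' [l' [kl' klE']]] := hom_cocycle_pair sftX hpsi.
exists (base_map phi), (base_map psi), k, l, k', l'; split=> //.
- split; [split | by exists k, l | by exists k', l'].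
  + exact: base_map_continuous.
  + exact: base_map_continuous.
  + exact: (base_mapK hphi phiK).
  + exact: (base_mapK hpsi psiK).
- exact: hom_induced.
- exact: hom_induced.
Qed.

(** * Least periods *)

Lemma eventually_periodicP {A : finType} {X : shift_space A} (x : X) :
  eventually_periodic x <-> exists p, is_period x p.
Proof.
split=> [/is_period_ex[p /asboolP]|[p [p0 [n [m [pE xE]]]]]]; first by exists p.
exists m, p => //; rewrite -iterD -[RHS]xE; congr (iter _ _ _); lia.
Qed.

Lemma is_period_sigma {A : finType} {X : shift_space A} (x : X) (p : nat) :
  is_period (sigma x) p <-> is_period x p.
Proof.
split=> -[p0 [n [m [pE xE]]]]; split=> //.
  by exists n.+1, m.+1; rewrite !iterSr; split=> //; lia.
by exists n, m; rewrite -!iterSr !iterS xE.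
Qed.

Lemma eq_lp {A : finType} {X : shift_space A} (x y : X) :
  (forall p, is_period x p <-> is_period y p) -> lp x = lp y.
Proof.
move=> xy; have [ex|nex] := pselect (eventually_periodic x).
  have ey : eventually_periodic y.
    move/eventually_periodicP: ex => [p /xy yp].
    by apply/eventually_periodicP; exists p.
  have [/xy xp xmin] := lpP ex; have [/xy yp ymin] := lpP ey.
  by apply/eqP; rewrite eqn_leq xmin // ymin.
(* If neither point is eventually periodic, both sides are the default value 0. *)
rewrite /lp; case: pselect => // ?; case: pselect => // ey.
have /eventually_periodicP[p /xy xp] := ey.
by case: nex; apply/eventually_periodicP; exists p.
Qed.

Lemma lp_iter {A : finType} {X : shift_space A} (n : nat) (x : X) :
  lp (iter n sigma x) = lp x.
Proof. by elim: n => //= n <-; apply: eq_lp => p; exact: is_period_sigma. Qed.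

Lemma lp_arrow_ends {A : finType} {X : shift_space A} (g : groupoid X) :
  lp (range_of g) = lp (source_of g).
Proof.
by have [i [j [_ ij]]] := tripleP g; rewrite -(lp_iter i) ij lp_iter.
Qed.

Lemma loop_eventually_periodic {A : finType} {X : shift_space A} (x : X)
    (t : int) :
  is_arrow (x, t, x) -> t != 0 -> eventually_periodic x.
Proof.
move=> [i [j [/= tE ij]]] t0; apply/eventually_periodicP.
have [ltij|ltji|eij] := ltngtP i j; last by rewrite tE eij subrr eqxx in t0.
  by exists (j - i)%N; split; [lia|exists j, i; split=> //; lia].
by exists (i - j)%N; split; [lia|exists i, j; split=> //; lia].
Qed.

(** Although [h] need not commute with [sigma], [phi] sends the arrow between [x] and
    [iter n sigma x] to one between their images, and the ends of an arrow have equal least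
    period. *)
Lemma induced_lp {A B : finType} {X : shift_space A} {Y : shift_space B}
    (phi : groupoid X -> groupoid Y) (h : X -> Y) (k l : X -> nat)
    (n : nat) (x : X) :
  induced_by phi h k l -> lp (h (iter n sigma x)) = lp (h x).
Proof.
move=> phiE.
have e : iter n sigma x = iter 0 sigma (iter n sigma x) by [].
have := lp_arrow_ends (phi (arrow_of e)).
by rewrite /range_of /source_of phiE.
Qed.

(** Write the arrow with exponents [n + lp x] and [n]: the sums over the transient cancel and one
    turn of the cycle remains. *)
Lemma induced_lp_arrow {A B : finType} {X : shift_space A}
    {Y : shift_space B} (phi : groupoid X -> groupoid Y) (h : X -> Y)
    (k l : X -> nat) (n : nat) (x : X) (ex : eventually_periodic x) :
  induced_by phi h k l -> periodic (iter n sigma x) ->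
  triple (phi (lp_arrow ex)) =
    (h x, cocycle_sum k l (lp x) (iter n sigma x), h x).
Proof.
move=> phiE /iter_lp[_]; rewrite lp_iter -iterD addnC => e.
have -> : lp_arrow ex = arrow_of e.
  by apply: triple_inj => /=; congr (_, _, _); lia.
by rewrite phiE cocycle_sumD addrAC subrr add0r.
Qed.

Lemma least_period_preservingP {A B : finType} {X : shift_space A}
    {Y : shift_space B} (phi : groupoid X -> groupoid Y) (h : X -> Y)
    (k l : X -> nat) :
  induced_by phi h k l ->
  least_period_preserving h k l <->
  forall (x : X) (ex : eventually_periodic x),
    triple (phi (lp_arrow ex)) = (h x, (lp (h x))%:Z, h x).
Proof.
move=> phiE; split=> [lpp x ex|phi_lp x px].
  have [n xn] := ex.
  rewrite (induced_lp_arrow ex phiE xn) -(lp_iter n x) -lpp //.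
  by rewrite (induced_lp n x phiE).
have := phi_lp x (periodic_eventually px).
by rewrite (@induced_lp_arrow _ _ _ _ _ _ _ _ 0 _ _ phiE px) => -[->].
Qed.

(** The hypothesis at [hinv y] says that [phi] maps its least period arrow to that of [y], so [psi]
    maps it back. What remains is that [hinv y] is eventually periodic. *)
Lemma least_period_preserving_inv {A B : finType} {X : shift_space A}
    {Y : shift_space B} (phi : groupoid X -> groupoid Y)
    (psi : groupoid Y -> groupoid X) (h : X -> Y) (hinv : Y -> X)
    (k' l' : Y -> nat) :
  cancel phi psi -> cancel psi phi -> cancel hinv h ->
  induced_by psi hinv k' l' ->
  (forall (x : X) (ex : eventually_periodic x),
     triple (phi (lp_arrow ex)) = (h x, (lp (h x))%:Z, h x)) ->
  least_period_preserving hinv k' l'.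
Proof.
move=> phiK psiK hinvK psiE phi_lp.
apply/(least_period_preservingP psiE) => y ey.
have [n yn] := ey; have psi_lp := induced_lp_arrow ey psiE yn.
have ex : eventually_periodic (hinv y).
  have := tripleP (psi (lp_arrow ey)); rewrite psi_lp.
  (* Degree 0 would make [psi] identify the least period arrow at [y] with the unit at [y], against
     injectivity and [lp y > 0]. *)
  move=> /loop_eventually_periodic; apply; apply/eqP => t0.
  have : psi (lp_arrow ey) = psi (unit_arrow y).
    by apply: triple_inj; rewrite psi_lp t0 psiE subrr.
  move=> /(can_inj psiK)/(congr1 degree); rewrite /degree /= => lp0.
  by have [[]] := lpP ey; rewrite -lez_nat => + _ _; lia.
have -> : lp_arrow ey = phi (lp_arrow ex).
  by apply: triple_inj; rewrite phi_lp hinvK.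
by rewrite phiK.
Qed.

Theorem proposition4p8 (A B : finType) (X : shift_space A) (Y : shift_space B)
    (sftX : finite_type X) (sftY : finite_type Y)
    (phi : groupoid X -> groupoid Y) (psi : groupoid Y -> groupoid X)
    (iso : groupoid_iso phi psi) :
  (exists (h : X -> Y) (hinv : Y -> X) (k l : X -> nat) (k' l' : Y -> nat),
     implements phi psi h hinv k l k' l') /\
  (forall (h : X -> Y) (hinv : Y -> X) (k l : X -> nat) (k' l' : Y -> nat),
     implements phi psi h hinv k l k' l' ->
     let lpp := least_period_preserving h k l /\
                least_period_preserving hinv k' l' in
     (lpp <-> forall (x : X) (ex : eventually_periodic x),
                triple (phi (lp_arrow ex)) = (h x, (lp (h x))%:Z, h x)) /\
     (lpp ->
        exists (b n : X -> nat) (b' n' : Y -> nat),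
          [/\ continuous b, continuous n, continuous b' & continuous n'] /\
          (forall x : X,
             (l x)%:Z - (k x)%:Z = (n x)%:Z + (b x)%:Z - (b (sigma x))%:Z) /\
          (forall y : Y,
             (l' y)%:Z - (k' y)%:Z =
               (n' y)%:Z + (b' y)%:Z - (b' (sigma y))%:Z))).
Proof.
split; first exact: iso_implements.
move=> h hinv k l k' l' [[hhinv _ _] [ck cl _] phiE [ck' cl' _] psiE] lpp.
have [_ _ _ hinvK] := hhinv; have [_ _ phiK psiK] := iso.
split; first split=> [[hlp _]|phi_lp].
- exact/(least_period_preservingP phiE).
- split; first exact/(least_period_preservingP phiE).
  exact: (least_period_preserving_inv phiK psiK hinvK psiE).
move=> [hlp hinvlp].
have [|b [n [cb cn E]]] := cohomologous_ge0 sftX ck cl.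
  (* The sum over a cycle is a least period, hence non-negative. *)
  by move=> x /hlp <-.
have [|b' [n' [cb' cn' E']]] := cohomologous_ge0 sftY ck' cl'.
  by move=> y /hinvlp <-.
by exists b, n, b', n'.
Qed.
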